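(* Let $\mathbf{C}$ be a propositional Hilbert-type calculus and let $m\ge 1$. The optimal $m$-valued covers of $\mathbf{C}$, i.e. those $m$-valued covers of $\mathbf{C}$ that are minimal under $\lhd$ among all $m$-valued covers of $\mathbf{C}$, are computable (there is an algorithm which computes them from $\mathbf{C}$ and $m$).
   Context: A propositional language $\mathcal{L}$ has propositional variables $X_0,X_1,X_2,\dots$ and finitely many connectives $\Box_0,\dots,\Box_r$ of fixed finite arities $n_0,\dots,n_r$ (arity $0$ means a constant). $\mathrm{Frm}(\mathcal{L})$ is the set of formulas. A propositional Hilbert-type calculus $\mathbf{C}$ in $\mathcal{L}$ is given by a finite set $A(\mathbf{C})\subseteq\mathrm{Frm}(\mathcal{L})$ of axioms and a finite set $R(\mathbf{C})$ of rules, each with premises $A_1,\dots,A_n$ and conclusion $A$, all in $\mathrm{Frm}(\mathcal{L})$ (axioms and rules are used in derivations up to substitution). An $m$-valued logic $\mathbf{M}$ over $\mathcal{L}$ is given by truth values $V(\mathbf{M})=\{1,\dots,m\}$, designated truth values $V^+(\mathbf{M})\subseteq V(\mathbf{M})$, and a truth function $V(\mathbf{M})^{n_j}\to V(\mathbf{M})$ for each connective $\Box_j$. A valuation maps variables to $V(\mathbf{M})$ and is extended to all formulas via the truth functions; it satisfies $F$ if the value of $F$ is in $V^+(\mathbf{M})$. $F$ is a tautology of $\mathbf{M}$ if every valuation satisfies it; $\mathrm{Taut}(\mathbf{M})$ is the set of tautologies. $\mathbf{M}$ is a cover for $\mathbf{C}$ (equivalently: $\mathbf{M}$ is normal for $\mathbf{C}$,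 $\mathbf{C}$ is strongly sound for $\mathbf{M}$) if all axioms in $A(\mathbf{C})$ are tautologies of $\mathbf{M}$ and, for every rule in $R(\mathbf{C})$, every valuation that satisfies the premises of the rule also satisfies its conclusion. $\mathbf{M}_1\unlhd\mathbf{M}_2$ iff $\mathrm{Taut}(\mathbf{M}_1)\subseteq\mathrm{Taut}(\mathbf{M}_2)$; $\mathbf{M}_1\lhd\mathbf{M}_2$ iff $\mathbf{M}_1\unlhd\mathbf{M}_2$ and $\mathrm{Taut}(\mathbf{M}_1)\ne\mathrm{Taut}(\mathbf{M}_2)$. *)

(* Defs.v *)
From Stdlib Require List.
From Stdlib Require Import Relation_Operators.
From mathcomp Require Import all_boot.

Set Implicit Arguments.
Unset Strict Implicit.
Unset Printing Implicit Defensive.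

(** * Propositional languages, calculi and finite-valued logics *)

(* The connectives are numbered 0, ..., [last_conn]. *)
Record language := Language {
  last_conn : nat;
  arity : 'I_last_conn.+1 -> nat
}.

Inductive formula (L : language) :=
| PropVar of nat
| Conn (j : 'I_(last_conn L).+1) of (formula L) ^ (arity j).

Record rule (L : language) := Rule {
  premises : seq (formula L);
  conclusion : formula L
}.

(* Finite sets of axioms and rules are given by lists; order and repetitions
   play no role in any of the notions below. *)
Record calculus (L : language) := Calculus {
  axioms : seq (formula L);
  rules : seq (rule L)
}.

(* The truth values 1, ..., m are represented by 0, ..., m - 1. *)
Definition mvlogic (L : language) (m : nat) : finType :=
  ({set 'I_m} *
   {dffun forall j : 'I_(last_conn L).+1,
      {ffun (arity j).-tuple 'I_m -> 'I_m}})%type.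

Section Semantics.
Variables (L : language) (m : nat).
Implicit Types (M : mvlogic L m) (v : nat -> 'I_m) (F : formula L).

Definition designated M : {set 'I_m} := M.1.

Definition truth M (j : 'I_(last_conn L).+1) :
  {ffun (arity j).-tuple 'I_m -> 'I_m} := M.2 j.

Fixpoint eval M v F : 'I_m :=
  match F with
  | PropVar n => v n
  | Conn j args => truth M j [tuple eval M v (args i) | i < arity j]
  end.

Definition satisfies M v F : Prop := eval M v F \in designated M.

Definition taut M F : Prop := forall v, satisfies M v F.

Definition cover (C : calculus L) M : Prop :=
  (forall A, List.In A (axioms C) -> taut M A) /\
  (forall r, List.In r (rules C) ->
   forall v, (forall A, List.In A (premises r) -> satisfies M v A) ->
             satisfies M v (conclusion r)).

Definition better_eq M1 M2 : Prop := forall F, taut M1 F -> taut M2 F.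

Definition better M1 M2 : Prop :=
  better_eq M1 M2 /\ ~ (forall F, taut M1 F <-> taut M2 F).

Definition optimal_cover (C : calculus L) M : Prop :=
  cover C M /\ forall M', cover C M' -> ~ better M' M.

End Semantics.

(** * The model of computation: the untyped lambda calculus

  Terms are in de Bruijn notation, with full beta reduction.  Data are
  represented by closed normal terms, using the Scott encoding. *)

Inductive term :=
| Var of nat
| App of term & term
| Lam of term.

Fixpoint closed_at (k : nat) (t : term) : bool :=
  match t with
  | Var n => n < k
  | App t1 t2 => closed_at k t1 && closed_at k t2
  | Lam t1 => closed_at k.+1 t1
  end.

Definition closed_term (t : term) : bool := closed_at 0 t.

Fixpoint lift_term (k : nat) (t : term) : term :=
  match t with
  | Var n => Var (if n < k then n else n.+1)
  | App t1 t2 => App (lift_term k t1) (lift_term k t2)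
  | Lam t1 => Lam (lift_term k.+1 t1)
  end.

(* Replaces the variable k by u and lowers the variables above k by one. *)
Fixpoint subst_term (k : nat) (u t : term) : term :=
  match t with
  | Var n => if n < k then Var n else if n == k then u else Var n.-1
  | App t1 t2 => App (subst_term k u t1) (subst_term k u t2)
  | Lam t1 => Lam (subst_term k.+1 (lift_term 0 u) t1)
  end.

Inductive beta : term -> term -> Prop :=
| beta_redex t u : beta (App (Lam t) u) (subst_term 0 u t)
| beta_appl t t' u : beta t t' -> beta (App t u) (App t' u)
| beta_appr t u u' : beta u u' -> beta (App t u) (App t u')
| beta_lam t t' : beta t t' -> beta (Lam t) (Lam t').

Definition reduces : term -> term -> Prop := clos_refl_trans term beta.

(* The i-th of k constructors (counting from 0), applied to closed arguments
   a_1, ..., a_p, is \c_0 ... c_(k-1). c_i a_1 ... a_p. *)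
Definition scott (k i : nat) (args : seq term) : term :=
  iter k Lam (foldl App (Var (k - i.+1)) args).

Fixpoint enc_nat (n : nat) : term :=
  if n is n'.+1 then scott 2 1 [:: enc_nat n'] else scott 2 0 [::].

Definition enc_pair (a b : term) : term := scott 1 0 [:: a; b].

Fixpoint enc_list (s : seq term) : term :=
  if s is a :: s' then scott 2 1 [:: a; enc_list s'] else scott 2 0 [::].

Section Encodings.
Variable L : language.

(* A language is coded as the list of its arities. *)
Definition enc_language : term :=
  enc_list [seq enc_nat (arity j) | j <- enum 'I_(last_conn L).+1].

Fixpoint enc_formula (F : formula L) : term :=
  match F with
  | PropVar n => scott 2 0 [:: enc_nat n]
  | Conn j args =>
      scott 2 1 [:: enc_nat j;
                    enc_list [seq enc_formula (args i) | i <- enum 'I_(arity j)]]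
  end.

Definition enc_rule (r : rule L) : term :=
  enc_pair (enc_list (map enc_formula (premises r)))
           (enc_formula (conclusion r)).

Definition enc_calculus (C : calculus L) : term :=
  enc_pair (enc_list (map enc_formula (axioms C)))
           (enc_list (map enc_rule (rules C))).

Variable m : nat.

(* All n-tuples of truth values, in lexicographic order. *)
Fixpoint all_tuples (n : nat) : seq (n.-tuple 'I_m) :=
  if n is n'.+1 then
    [seq [tuple of i :: w] | i : 'I_m <- enum 'I_m,
                              w : n'.-tuple 'I_m <- all_tuples n']
  else [:: [tuple]].

(* A truth function is coded as its table: the list of all pairs of an argument
   list and the corresponding value. *)
Definition enc_table (n : nat) (f : {ffun n.-tuple 'I_m -> 'I_m}) : term :=
  enc_list [seq enc_pair (enc_list [seq enc_nat (val i) | i <- tval w])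
                         (enc_nat (f w))
           | w <- all_tuples n].

Definition enc_logic (M : mvlogic L m) : term :=
  enc_pair (enc_list [seq enc_nat (val i) | i <- enum (designated M)])
           (enc_list [seq enc_table (truth M j)
                     | j <- enum 'I_(last_conn L).+1]).

End Encodings.

(* Main.v *)
Require Import Defs.
From mathcomp Require Import all_boot.
From Stdlib Require Import Relation_Operators Setoid Morphisms.

Set Implicit Arguments.
Unset Strict Implicit.
Unset Printing Implicit Defensive.

(** There are finitely many m-valued logics over a given language, so the
    optimal covers are found by exhaustive search once two properties are
    decided: that a logic covers the calculus, and that every tautology of M1
    is a tautology of M2.  The former depends only on the values of the
    finitely many variables that occur in the calculus ([coverbP]).

    For the latter, suppose that a tautology F of M1 is refuted in M2 by the
    valuation v.  Renaming each X_n to X_(v n) yields a formula in the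
    variables X_0, ..., X_(m-1) which is still a tautology of M1, being an
    instance of F, and is refuted in M2 by the valuation that sends X_i to i.
    So only formulas in m variables matter, and each of these matters only
    through the pair of functions V^m -> V which it defines in M1 and in M2.
    The set of definable pairs is the least fixed point of a monotone operator
    on the subsets of a set with (m^(m^m))^2 elements, hence it is reached
    after that many steps: every formula in m variables behaves in M1 and M2
    like one of bounded depth ([behaviour_fixset], [behaviour_iter]).
    Inclusion of tautologies is therefore decided by inspecting the finite
    list of formulas in m variables up to that depth ([better_eqbP]).

    A lambda term that carries out this search is not written down explicitly.
    Instead, formulas, calculi and logics are represented by first-order data
    whose codes are the prescribed ones, and the functions between such data
    that are represented by closed terms are shown to be closed under
    composition, pairing, conditionals, iteration, right folds of lists and
    folds of formulas.  The decision procedure is an ordinary function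
    composed from these operations, so it has a term
    ([computable_optimal_covers]), and its correctness is a statement about
    that function ([mem_optimal_covers]). *)

(** * Reduction of lambda terms *)

#[local] Instance reduces_preorder : PreOrder reduces.
Proof.
by split=> [t|t u v tu uv]; [apply: rt_refl | apply: rt_trans tu uv].
Qed.

#[local] Instance App_reduces : Proper (reduces ==> reduces ==> reduces) App.
Proof.
move=> t t' tt' u u' uu'; transitivity (App t' u).
  elim: tt' => {t t'} [t t' tt'|t|t s v _ IH1 _ IH2].
  - by apply: rt_step; apply: beta_appl.
  - exact: rt_refl.
  - by transitivity (App s u).
elim: uu' => {u u'} [u u' uu'|u|u s v _ IH1 _ IH2].
- by apply: rt_step; apply: beta_appr.
- exact: rt_refl.
- by transitivity (App t' s).
Qed.

#[local] Instance Lam_reduces : Proper (reduces ==> reduces) Lam.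
Proof.
move=> t t' tt'; elim: tt' => {t t'} [t t' tt'|t|t s v _ IH1 _ IH2].
- by apply: rt_step; apply: beta_lam.
- exact: rt_refl.
- by transitivity (Lam s).
Qed.

Lemma closed_atW k l t : closed_at k t -> k <= l -> closed_at l t.
Proof.
elim: t k l => [n|t IHt u IHu|t IHt] k l /=.
- by move=> nk kl; apply: leq_trans kl.
- by case/andP=> ct cu kl; apply/andP; split;
    [apply: IHt ct kl | apply: IHu cu kl].
- by move=> ct kl; apply: (IHt k.+1).
Qed.

Lemma closed_termW k t : closed_term t -> closed_at k t.
Proof. by move=> ct; apply: closed_atW ct _. Qed.

Lemma lift_closed k t : closed_at k t -> lift_term k t = t.
Proof.
elim: t k => [n|t IHt u IHu|t IHt] k /=.
- by move=> ->.
- by move=> /andP[ct cu]; rewrite IHt ?IHu.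
- by move=> ct; rewrite IHt.
Qed.

(** Substitution of a closed term, which needs no lifting.  Indices are
    compared by a function that simplifies on numerals, so that contracting a
    concrete redex is a matter of simplification. *)
Fixpoint inst (k : nat) (u t : term) : term :=
  match t with
  | Var n => match Nat.compare n k with
             | Lt => Var n | Eq => u | Gt => Var n.-1 end
  | App t1 t2 => App (inst k u t1) (inst k u t2)
  | Lam t1 => Lam (inst k.+1 u t1)
  end.

Lemma subst_closed k u t : closed_term u -> subst_term k u t = inst k u t.
Proof.
move=> cu; elim: t k => [n|t IHt s IHs|t IHt] k /=.
- case: (PeanoNat.Nat.compare_spec n k) => [->|/ltP nk|/ltP kn].
  + by rewrite ltnn eqxx.
  + by rewrite nk.
  + by rewrite ltnNge (ltnW kn) gtn_eqF.
- by rewrite IHt IHs.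
- by rewrite lift_closed // IHt.
Qed.

Lemma inst_closed_at k u t : closed_at k t -> inst k u t = t.
Proof.
elim: t k => [n|t IHt s IHs|t IHt] k /=.
- by move=> nk; case: (PeanoNat.Nat.compare_spec n k) nk => // [->|/ltP kn];
    [rewrite ltnn | rewrite ltnNge ltnW].
- by move=> /andP[ct cs]; rewrite IHt ?IHs.
- by move=> ct; rewrite IHt.
Qed.

Lemma inst_closed k u t : closed_term t -> inst k u t = t.
Proof. by move=> ct; apply/inst_closed_at/closed_termW. Qed.

Lemma red_beta t u : closed_term u -> reduces (App (Lam t) u) (inst 0 u t).
Proof.
by move=> cu; rewrite -subst_closed //; apply: rt_step; apply: beta_redex.
Qed.

Ltac closed := rewrite /closed_term /=;
  repeat (apply/andP; split); try (by []);
  try (by apply: closed_termW; auto); auto.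

(** Contracts a redex whose argument is closed.  Closed subterms of the body,
    such as the terms representing already known functions, stay folded. *)
Ltac reduce :=
  setoid_rewrite red_beta;
  [rewrite /= ?inst_closed //; try by closed | by closed].

(** * Scott encodings *)

Definition tpair := Lam (Lam (Lam (App (App (Var 0) (Var 2)) (Var 1)))).
Definition tcons := Lam (Lam (Lam (Lam (App (App (Var 0) (Var 3)) (Var 2))))).

Lemma closed_enc_pair a b :
  closed_term a -> closed_term b -> closed_term (enc_pair a b).
Proof. by move=> ca cb; closed. Qed.

Lemma closed_enc_list s : all closed_term s -> closed_term (enc_list s).
Proof. by elim: s => [|a s IHs] //= /andP[ca /IHs cs]; closed. Qed.

Lemma closed_enc_nat n : closed_term (enc_nat n).
Proof. by elim: n => [|n IHn] //; closed. Qed.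

Lemma red_tpair a b : closed_term a -> closed_term b ->
  reduces (App (App tpair a) b) (enc_pair a b).
Proof. by move=> ca cb; do 2!reduce; reflexivity. Qed.

(** The same term serves for every second constructor of two with two fields:
    non-empty lists and compound formulas. *)
Lemma red_tcons a s : closed_term a -> closed_term s ->
  reduces (App (App tcons a) s) (scott 2 1 [:: a; s]).
Proof. by move=> ca cs; do 2!reduce; reflexivity. Qed.

Lemma scott_cons_reduces a a' s s' : reduces a a' -> reduces s s' ->
  reduces (scott 2 1 [:: a; s]) (scott 2 1 [:: a'; s']).
Proof.
by move=> aa' ss'; do 2!apply: Lam_reduces; do 2!apply: App_reduces => //;
  reflexivity.
Qed.

Lemma red_case_pair a b x : closed_term a -> closed_term b -> closed_term x ->
  reduces (App (enc_pair a b) x) (App (App x a) b).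
Proof.
by move=> ca cb cx; rewrite /enc_pair /scott /=; reduce; reflexivity.
Qed.

Lemma red_case_const (b : bool) x y : closed_term x -> closed_term y ->
  reduces (App (App (scott 2 b [::]) x) y) (if b then y else x).
Proof.
by move=> cx cy; case: b; rewrite /scott /=; do 2!reduce; reflexivity.
Qed.

Lemma red_case_cons a s x y :
    closed_term a -> closed_term s -> closed_term x -> closed_term y ->
  reduces (App (App (scott 2 1 [:: a; s]) x) y) (App (App y a) s).
Proof. by move=> ca cs cx cy; rewrite /scott /=; do 2!reduce; reflexivity. Qed.

Lemma red_case_left a x y : closed_term a -> closed_term x -> closed_term y ->
  reduces (App (App (scott 2 0 [:: a]) x) y) (App x a).
Proof. by move=> ca cx cy; rewrite /scott /=; do 2!reduce; reflexivity. Qed.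

Lemma red_case_right a x y : closed_term a -> closed_term x -> closed_term y ->
  reduces (App (App (scott 2 1 [:: a]) x) y) (App y a).
Proof. by move=> ca cx cy; rewrite /scott /=; do 2!reduce; reflexivity. Qed.

(** Turing's fixed point combinator, which unlike Curry's really reduces to the
    unfolded form; this is what recursive functions are built from. *)
Lemma fixpoint_term F : closed_term F ->
  exists2 R, closed_term R & reduces R (App F R).
Proof.
move=> cF.
pose A := Lam (Lam (App (Var 0) (App (App (Var 1) (Var 1)) (Var 0)))).
exists (App (App A A) F); first by closed.
by rewrite {1}/A; do 2!reduce; reflexivity.
Qed.

(** * Computable functions on Scott-encoded data *)

Class codable (X : Type) := Codable {
  enc : X -> term;
  enc_closed : forall x, closed_term (enc x)
}.

#[local] Hint Resolve enc_closed : core.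

#[local] Instance nat_codable : codable nat := Codable closed_enc_nat.

#[local] Instance bool_codable : codable bool.
Proof. by exists (fun b : bool => scott 2 b [::]); case. Defined.

#[local] Instance pair_codable X Y : codable X -> codable Y -> codable (X * Y).
Proof.
move=> cX cY; exists (fun p => enc_pair (enc p.1) (enc p.2)) => p.
exact: closed_enc_pair.
Defined.

Lemma closed_map_enc X (cX : codable X) s : all closed_term (map enc s).
Proof. by elim: s => //= x s ->; rewrite enc_closed. Qed.

#[local] Instance seq_codable X : codable X -> codable (seq X).
Proof.
by move=> cX; exists (fun s => enc_list (map enc s)) => s;
  apply/closed_enc_list/closed_map_enc.
Defined.

(** Formulas without arity constraints: leaves are variables, and the label of
    a node is the number of its connective. *)
Notation raw_formula := (GenTree.tree nat).

Fixpoint enc_raw_formula (F : raw_formula) : term :=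
  match F with
  | GenTree.Leaf n => scott 2 0 [:: enc n]
  | GenTree.Node j s =>
      scott 2 1 [:: enc j; enc_list (map enc_raw_formula s)]
  end.

Lemma closed_enc_raw_formula F : closed_term (enc_raw_formula F).
Proof.
elim: F => [n|j s IHs] /=; first by have cn := closed_enc_nat n; closed.
suff cs: closed_term (enc_list (map enc_raw_formula s)).
  by have cj := closed_enc_nat j; closed.
by apply: closed_enc_list; elim: s IHs => //= F s IHs [-> /IHs].
Qed.

#[local] Instance formula_codable : codable raw_formula :=
  Codable closed_enc_raw_formula.

Definition computable {X Y} {cX : codable X} {cY : codable Y} (f : X -> Y) :=
  exists2 t, closed_term t & forall x, reduces (App t (enc x)) (enc (f x)).

(** The closure properties below are stated for functions of an environment
    [e].  A binder inside an operation extends the environment by pairing, so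
    that the functions passed to iterations and folds take a single argument. *)
Section Closure.
Context {E : Type} {cE : codable E}.

Lemma computable_id : computable (fun e : E => e).
Proof. by exists (Lam (Var 0)) => // x; reduce; reflexivity. Qed.

Lemma computable_const X (cX : codable X) (x : X) :
  computable (fun _ : E => x).
Proof.
have cx : closed_term (enc x) by [].
by exists (Lam (enc x)) => [|e]; [closed | reduce; reflexivity].
Qed.

Lemma computable_comp X Y (cX : codable X) (cY : codable Y)
    (g : X -> Y) (f : E -> X) :
  computable g -> computable f -> computable (fun e => g (f e)).
Proof.
move=> [u cu uE] [t ct tE]; exists (Lam (App u (App t (Var 0)))) => [|e].
  by closed.
by reduce; setoid_rewrite tE; setoid_rewrite uE; reflexivity.
Qed.

Lemma computable_op2 X Y Z (cX : codable X) (cY : codable Y) (cZ : codable Z)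
    (h : X -> Y -> Z) (f : E -> X) (g : E -> Y) :
  (exists2 t, closed_term t &
    forall x y, reduces (App (App t (enc x)) (enc y)) (enc (h x y))) ->
  computable f -> computable g -> computable (fun e => h (f e) (g e)).
Proof.
move=> [t ct tE] [u cu uE] [v cv vE].
exists (Lam (App (App t (App u (Var 0))) (App v (Var 0)))) => [|e].
  by closed.
by reduce; setoid_rewrite uE; setoid_rewrite vE; setoid_rewrite tE; reflexivity.
Qed.

Lemma computable_pair X Y (cX : codable X) (cY : codable Y)
    (f : E -> X) (g : E -> Y) :
  computable f -> computable g -> computable (fun e => (f e, g e)).
Proof.
apply: computable_op2; exists tpair => // x y.
exact: red_tpair.
Qed.

Lemma computable_fst X Y (cX : codable X) (cY : codable Y) (f : E -> X * Y) :
  computable f -> computable (fun e => (f e).1).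
Proof.
apply: computable_comp; exists (Lam (App (Var 0) (Lam (Lam (Var 1))))) => // x.
by reduce; setoid_rewrite red_case_pair => //; do 2!reduce; reflexivity.
Qed.

Lemma computable_snd X Y (cX : codable X) (cY : codable Y) (f : E -> X * Y) :
  computable f -> computable (fun e => (f e).2).
Proof.
apply: computable_comp; exists (Lam (App (Var 0) (Lam (Lam (Var 0))))) => // x.
by reduce; setoid_rewrite red_case_pair => //; do 2!reduce; reflexivity.
Qed.

Lemma computable_cons X (cX : codable X) (f : E -> X) (g : E -> seq X) :
  computable f -> computable g -> computable (fun e => f e :: g e).
Proof.
apply: computable_op2; exists tcons => // x s.
by apply: red_tcons => //; apply: enc_closed s.
Qed.

Lemma computable_succ (f : E -> nat) :
  computable f -> computable (fun e => (f e).+1).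
Proof.
apply: computable_comp; exists (Lam (Lam (Lam (App (Var 0) (Var 2))))) => // n.
by have cn := closed_enc_nat n; reduce; reflexivity.
Qed.

Lemma computable_Leaf (f : E -> nat) :
  computable f -> computable (fun e => GenTree.Leaf (f e)).
Proof.
apply: computable_comp; exists (Lam (Lam (Lam (App (Var 1) (Var 2))))) => // n.
by have cn := closed_enc_nat n; reduce; reflexivity.
Qed.

Lemma computable_Node (f : E -> nat) (g : E -> seq raw_formula) :
  computable f -> computable g ->
  computable (fun e => GenTree.Node (f e) (g e)).
Proof.
apply: computable_op2; exists tcons => // j s.
by apply: red_tcons; [apply: enc_closed j | apply: enc_closed s].
Qed.

Lemma computable_if X (cX : codable X) (b : E -> bool) (f g : E -> X) :
  computable b -> computable f -> computable g ->
  computable (fun e => if b e then f e else g e).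
Proof.
move=> [t ct tE] [u cu uE] [v cv vE].
exists (Lam (App (App (App t (Var 0)) (App v (Var 0))) (App u (Var 0)))).
  by closed.
move=> e.
reduce; setoid_rewrite uE; setoid_rewrite vE; setoid_rewrite tE.
rewrite (_ : enc (if b e then f e else g e) =
             if b e then enc (f e) else enc (g e)); last by case: (b e).
exact: red_case_const.
Qed.

Lemma computable_iter X (cX : codable X) (n : E -> nat) (f : E -> X -> X)
    (z : E -> X) :
  computable n -> computable z -> computable (fun p : E * X => f p.1 p.2) ->
  computable (fun e => iter (n e) (f e) (z e)).
Proof.
move=> [t ct tE] [u cu uE] [v cv vE].
pose F := Lam (Lam (Lam (App (App (Var 0) (App u (Var 1)))
  (Lam (App v (App (App tpair (Var 2))
                   (App (App (Var 3) (Var 2)) (Var 0)))))))).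
have [R cR RE] : exists2 R, closed_term R & reduces R (App F R).
  by apply: fixpoint_term; closed.
exists (Lam (App (App R (Var 0)) (App t (Var 0)))) => [|e]; first by closed.
reduce; setoid_rewrite tE; have ce : closed_term (enc e) by [].
elim: (n e) => [|k IHk] /=.
  setoid_rewrite RE; rewrite {1}/F; do 3!reduce.
  by setoid_rewrite (red_case_const false) => //; closed.
have ck := closed_enc_nat k.
setoid_rewrite RE; rewrite {1}/F; do 3!reduce.
setoid_rewrite red_case_right => //; try by closed.
reduce; setoid_rewrite IHk; setoid_rewrite red_tpair => //.
exact: (vE (e, _)).
Qed.

Lemma computable_foldr X Y (cX : codable X) (cY : codable Y) (s : E -> seq X)
    (f : E -> X -> Y -> Y) (z : E -> Y) :
  computable s -> computable z ->
  computable (fun p : E * X * Y => f p.1.1 p.1.2 p.2) ->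
  computable (fun e => foldr (f e) (z e) (s e)).
Proof.
move=> [t ct tE] [u cu uE] [v cv vE].
pose F := Lam (Lam (Lam (App (App (Var 0) (App u (Var 1)))
  (Lam (Lam (App v (App (App tpair (App (App tpair (Var 3)) (Var 1)))
                        (App (App (Var 4) (Var 3)) (Var 0))))))))).
have [R cR RE] : exists2 R, closed_term R & reduces R (App F R).
  by apply: fixpoint_term; closed.
exists (Lam (App (App R (Var 0)) (App t (Var 0)))) => [|e]; first by closed.
reduce; setoid_rewrite tE; have ce : closed_term (enc e) by [].
elim: (s e) => [|x s' IHs] /=.
  setoid_rewrite RE; rewrite {1}/F; do 3!reduce.
  by setoid_rewrite (red_case_const false) => //; closed.
have cx : closed_term (enc x) by [].
have cs : closed_term (enc_list (map enc s')) by apply: enc_closed s'.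
setoid_rewrite RE; rewrite {1}/F; do 3!reduce.
setoid_rewrite red_case_cons => //; try by closed.
do 2!reduce; setoid_rewrite IHs; setoid_rewrite (red_tpair ce cx).
setoid_rewrite red_tpair => //; last exact: closed_enc_pair.
exact: (vE (e, x, _)).
Qed.

(** Folds a formula, with the value of the variables given by [fv] and the
    action of the connectives on the list of values of the arguments by [fc]. *)
Fixpoint formula_fold B (fv : nat -> B) (fc : nat -> seq B -> B)
    (F : raw_formula) : B :=
  match F with
  | GenTree.Leaf n => fv n
  | GenTree.Node j s => fc j (map (formula_fold fv fc) s)
  end.

(** Folding a formula needs a second recursion, over the list of arguments.  It
    is isolated here, for an arbitrary term [g] in place of the recursive call;
    the results [App g a] are left unevaluated. *)
Lemma map_term : exists2 M, closed_term M &
  forall g s, closed_term g -> all closed_term s ->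
    reduces (App (App M g) (enc_list s)) (enc_list (map (App g) s)).
Proof.
pose F := Lam (Lam (Lam (App (App (Var 0) (enc_list [::]))
  (Lam (Lam (App (App tcons (App (Var 3) (Var 1)))
                 (App (App (Var 4) (Var 3)) (Var 0)))))))).
have [M cM ME] : exists2 M, closed_term M & reduces M (App F M).
  exact: fixpoint_term.
exists M => // g s cg; elim: s => [|a s IHs] /=.
  move=> _; setoid_rewrite ME; rewrite {1}/F; do 3!reduce.
  by apply: (red_case_const false); closed.
move=> /andP[ca cs]; have cs' := closed_enc_list cs.
have cms : closed_term (enc_list (map (App g) s)).
  by apply: closed_enc_list; elim: s cs {IHs cs'} => //= b s IHs /andP[cb /IHs];
    move=> ->; closed.
setoid_rewrite ME; rewrite {1}/F; do 3!reduce.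
setoid_rewrite red_case_cons => //; try by closed.
do 2!reduce; setoid_rewrite (IHs cs); apply: red_tcons => //; closed.
Qed.

Lemma computable_formula_fold B (cB : codable B) (F : E -> raw_formula)
    (fv : E -> nat -> B) (fc : E -> nat -> seq B -> B) :
  computable F -> computable (fun p : E * nat => fv p.1 p.2) ->
  computable (fun p : E * nat * seq B => fc p.1.1 p.1.2 p.2) ->
  computable (fun e => formula_fold (fv e) (fc e) (F e)).
Proof.
move=> [t ct tE] [u cu uE] [v cv vE]; have [M cM ME] := map_term.
pose G := Lam (Lam (Lam (App (App (Var 0)
  (Lam (App u (App (App tpair (Var 2)) (Var 0)))))
  (Lam (Lam (App v (App (App tpair (App (App tpair (Var 3)) (Var 1)))
                        (App (App M (App (Var 4) (Var 3))) (Var 0))))))))).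
have [R cR RE] : exists2 R, closed_term R & reduces R (App G R).
  by apply: fixpoint_term; closed.
exists (Lam (App (App R (Var 0)) (App t (Var 0)))) => [|e]; first by closed.
reduce; setoid_rewrite tE; have ce : closed_term (enc e) by [].
elim: (F e) => [n|j s IHs] /=.
  have cn := closed_enc_nat n.
  setoid_rewrite RE; rewrite {1}/G; do 3!reduce.
  setoid_rewrite red_case_left => //; try by closed.
  by reduce; setoid_rewrite red_tpair => //; apply: (uE (e, n)).
have cj := closed_enc_nat j.
have cs : all closed_term (map enc_raw_formula s) :=
  closed_map_enc formula_codable s.
have cs' := closed_enc_list cs.
setoid_rewrite RE; rewrite {1}/G; do 3!reduce.
setoid_rewrite red_case_cons => //; try by closed.
do 2!reduce; setoid_rewrite ME => //; last by closed.
have sE : reduces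
    (enc_list (map (App (App R (enc e))) (map enc_raw_formula s)))
    (enc (map (formula_fold (fv e) (fc e)) s)).
  elim: s IHs {cs cs'} => [|H s IH] /=; first by move=> _; reflexivity.
  by move=> [HE /IH tlE]; apply: scott_cons_reduces.
setoid_rewrite sE; setoid_rewrite (red_tpair ce cj).
setoid_rewrite red_tpair => //; last exact: closed_enc_pair.
exact: (vE (e, j, _)).
Qed.

End Closure.

(** Decomposes a function of the environment along the basic operations.  The
    components are read off by matching, so that the instances of [codable]
    are inferred from known types. *)
Ltac computability :=
  cbn beta; first [assumption | lazymatch goal with
  | |- computable (fun e => e) => exact: computable_id
  | |- computable (fun e => (@?f e, @?g e)) =>
      apply: (computable_pair (f := f) (g := g)); computability
  | |- computable (@fst _ _) => exact: (computable_fst computable_id)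
  | |- computable (@snd _ _) => exact: (computable_snd computable_id)
  | |- computable (fun e => fst (@?f e)) =>
      apply: (computable_fst (f := f)); computability
  | |- computable (fun e => snd (@?f e)) =>
      apply: (computable_snd (f := f)); computability
  | |- computable (fun e => @?f e :: @?g e) =>
      apply: (computable_cons (f := f) (g := g)); computability
  | |- computable (fun e => (@?f e).+1) =>
      apply: (computable_succ (f := f)); computability
  | |- computable (fun e => GenTree.Leaf (@?f e)) =>
      apply: (computable_Leaf (f := f)); computability
  | |- computable (fun e => GenTree.Node (@?f e) (@?g e)) =>
      apply: (computable_Node (f := f) (g := g)); computability
  | |- computable (fun e => if _ then _ else _) =>
      apply: computable_if; computability
  | |- computable (fun e => iter (@?n e) (@?f e) (@?z e)) =>
      apply: (computable_iter (n := n) (f := f) (z := z)); computability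
  | |- computable (fun e => foldr (@?f e) (@?z e) (@?s e)) =>
      apply: (computable_foldr (s := s) (f := f) (z := z)); computability
  | |- computable (fun e => formula_fold (@?f e) (@?g e) (@?F e)) =>
      apply: (computable_formula_fold (F := F) (fv := f) (fc := g));
      computability
  | |- _ => first [exact: computable_const | idtac]
  end].

(** Reduces a function of two arguments to the case where they are the two
    components of the environment, so that the arguments need not be
    transported under binders. *)
Lemma computable_comp2 E X Y Z (cE : codable E) (cX : codable X)
    (cY : codable Y) (cZ : codable Z) (h : X -> Y -> Z) (f : E -> X)
    (g : E -> Y) :
  computable (fun p : X * Y => h p.1 p.2) -> computable f -> computable g ->
  computable (fun e => h (f e) (g e)).
Proof.
move=> ch cf cg; apply: (computable_comp (f := fun e => (f e, g e))) ch _.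
exact: computable_pair.
Qed.

Lemma computable_comp3 E X Y Z W (cE : codable E) (cX : codable X)
    (cY : codable Y) (cZ : codable Z) (cW : codable W) (h : X -> Y -> Z -> W)
    (f : E -> X) (g : E -> Y) (k : E -> Z) :
  computable (fun p : X * Y * Z => h p.1.1 p.1.2 p.2) ->
  computable f -> computable g -> computable k ->
  computable (fun e => h (f e) (g e) (k e)).
Proof.
move=> ch cf cg ck.
apply: (computable_comp (f := fun e => (f e, g e, k e))) ch _.
by do 2?apply: computable_pair.
Qed.

Lemma computable_ext X Y (cX : codable X) (cY : codable Y) (f g : X -> Y) :
  f =1 g -> computable g -> computable f.
Proof. by move=> fg [t ct tE]; exists t => // x; rewrite fg; apply: tE. Qed.

Lemma computable_cat E X (cE : codable E) (cX : codable X) (s t : E -> seq X) :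
  computable s -> computable t -> computable (fun e => s e ++ t e).
Proof.
move=> cs ct; apply: (computable_ext (g := fun e => foldr cons (t e) (s e))).
  by move=> e; elim: (s e) => //= x s' ->.
computability.
Qed.

Lemma computable_map E X Y (cE : codable E) (cX : codable X) (cY : codable Y)
    (f : E -> X -> Y) (s : E -> seq X) :
  computable s -> computable (fun p : E * X => f p.1 p.2) ->
  computable (fun e => map (f e) (s e)).
Proof.
move=> cs cf.
apply: (computable_ext
  (g := fun e => foldr (fun x t => f e x :: t) [::] (s e))).
  by move=> e; elim: (s e) => //= x s' ->.
by computability; apply: (computable_comp cf); computability.
Qed.

Lemma computable_filter E X (cE : codable E) (cX : codable X)
    (a : E -> X -> bool) (s : E -> seq X) :
  computable s -> computable (fun p : E * X => a p.1 p.2) ->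
  computable (fun e => filter (a e) (s e)).
Proof.
move=> cs ca.
apply: (computable_ext
  (g := fun e => foldr (fun x t => if a e x then x :: t else t) [::] (s e))).
  by move=> e; elim: (s e) => //= x s' ->.
by computability; apply: (computable_comp ca); computability.
Qed.

Lemma computable_all E X (cE : codable E) (cX : codable X)
    (a : E -> X -> bool) (s : E -> seq X) :
  computable s -> computable (fun p : E * X => a p.1 p.2) ->
  computable (fun e => all (a e) (s e)).
Proof.
move=> cs ca.
apply: (computable_ext
  (g := fun e => foldr (fun x b => if a e x then b else false) true (s e))).
  by move=> e; elim: (s e) => //= x s' ->.
by computability; apply: (computable_comp ca); computability.
Qed.

Lemma computable_flatten E X (cE : codable E) (cX : codable X)
    (s : E -> seq (seq X)) :
  computable s -> computable (fun e => flatten (s e)).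
Proof.
move=> cs; rewrite /flatten; computability.
by apply: computable_cat; computability.
Qed.

Lemma computable_size E X (cE : codable E) (cX : codable X) (s : E -> seq X) :
  computable s -> computable (fun e => size (s e)).
Proof.
move=> cs.
apply: (computable_ext (g := fun e => foldr (fun _ n => n.+1) 0 (s e))).
  by move=> e; elim: (s e) => //= x s' ->.
by computability.
Qed.

Lemma computable_nth E X (cE : codable E) (cX : codable X) x0
    (s : E -> seq X) (i : E -> nat) :
  computable s -> computable i -> computable (fun e => nth x0 (s e) (i e)).
Proof.
(* Right folds see no tails, so [behead] is the second component of the fold
   that computes a list together with its tail. *)
move=> cs ci; pose tl (t : seq X) :=
  (foldr (fun x p => (x :: p.1, p.1)) ([::], [::]) t).2.
apply: (computable_ext (g := fun e =>
    foldr (fun x _ => x) x0 (iter (i e) tl (s e)))).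
  move=> e; have tlE : tl =1 behead.
    rewrite /tl => -[|x t] //=.
    by elim: t => //= y t; case: (foldr _ _ _) => a b /= <-.
  rewrite (eq_iter tlE) -drop_behead -[i e in LHS]addn0 -nth_drop.
  by case: (drop _ _).
by rewrite /tl; computability.
Qed.

Lemma computable_nseq E X (cE : codable E) (cX : codable X)
    (n : E -> nat) (x : E -> X) :
  computable n -> computable x -> computable (fun e => nseq (n e) (x e)).
Proof.
move=> cn cx; rewrite /nseq /ncons; computability.
by apply: (computable_comp cx); computability.
Qed.

Lemma computable_iota E (cE : codable E) (n : E -> nat) :
  computable n -> computable (fun e => iota 0 (n e)).
Proof.
move=> cn; apply: (computable_ext (g := fun e =>
    iter (n e) (fun s => 0 :: foldr (fun i t => i.+1 :: t) [::] s) [::])).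
  move=> e; elim: (n e) => //= k <-; rewrite (iotaDl 1 0).
  by congr (_ :: _); elim: (iota 0 k) => //= i s ->.
by computability.
Qed.


Lemma computable_and E (cE : codable E) (a b : E -> bool) :
  computable a -> computable b -> computable (fun e => a e && b e).
Proof. by move=> ca cb; rewrite /andb; computability. Qed.

Lemma computable_implies E (cE : codable E) (a b : E -> bool) :
  computable a -> computable b -> computable (fun e => a e ==> b e).
Proof. by move=> ca cb; rewrite /implb; computability. Qed.

Lemma computable_add E (cE : codable E) (f g : E -> nat) :
  computable f -> computable g -> computable (fun e => f e + g e).
Proof.
move=> cf cg; apply: (computable_ext (g := fun e => iter (f e) succn (g e))).
  by move=> e; rewrite iter_succn addnC.
by computability.
Qed.

Lemma computable_mul E (cE : codable E) (f g : E -> nat) :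
  computable f -> computable g -> computable (fun e => f e * g e).
Proof.
move=> cf cg.
apply: (computable_ext (g := fun e => iter (f e) (addn (g e)) 0)).
  by move=> e; rewrite iter_addn_0 mulnC.
computability; apply: computable_add; computability.
by apply: (computable_comp cg); computability.
Qed.

Lemma computable_exp E (cE : codable E) (f g : E -> nat) :
  computable f -> computable g -> computable (fun e => f e ^ g e).
Proof.
move=> cf cg.
apply: (computable_ext (g := fun e => iter (g e) (muln (f e)) 1)).
  by move=> e; rewrite iter_muln_1.
computability; apply: computable_mul; computability.
by apply: (computable_comp cf); computability.
Qed.

Lemma computable_sub E (cE : codable E) (f g : E -> nat) :
  computable f -> computable g -> computable (fun e => f e - g e).
Proof.
(* The predecessor is obtained by iterating on pairs (k, k - 1). *)
move=> cf cg; pose pred' k := (iter k (fun p => (p.1.+1, p.1)) (0, 0)).2.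
apply: (computable_ext (g := fun e => iter (g e) pred' (f e))).
  move=> e; rewrite -iter_predn; apply: eq_iter => -[|k] //=.
  by rewrite /pred' /=; elim: k => //= k {1}->.
by rewrite /pred'; computability.
Qed.

Lemma computable_max E (cE : codable E) (f g : E -> nat) :
  computable f -> computable g -> computable (fun e => maxn (f e) (g e)).
Proof.
move=> cf cg; apply: (computable_ext (g := fun e => f e + (g e - f e))).
  by move=> e; rewrite maxnE.
by apply: computable_add => //; apply: computable_sub.
Qed.

Lemma computable_eqn E (cE : codable E) (f g : E -> nat) :
  computable f -> computable g -> computable (fun e => f e == g e).
Proof.
move=> cf cg; apply: (computable_ext (g := fun e =>
    iter (f e - g e + (g e - f e)) (fun _ => false) true)).
  move=> e; rewrite eqn_leq -!subn_eq0 -addn_eq0.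
  by case: (_ + _).
computability; apply: computable_add; exact: computable_sub.
Qed.

Lemma computable_eqseq E (cE : codable E) (s t : E -> seq nat) :
  computable s -> computable t -> computable (fun e => s e == t e).
Proof.
move=> cs ct; apply: (computable_ext (g := fun e =>
    (size (s e) == size (t e)) &&
    all (fun i => nth 0 (s e) i == nth 0 (t e) i) (iota 0 (size (s e))))).
  move=> e; apply/eqP/andP => [-> | [/eqP st /allP eq_st]].
    by split=> //; apply/allP.
  apply: (eq_from_nth (x0 := 0)) => // i i_s.
  by apply/eqP/eq_st; rewrite mem_iota.
apply: computable_and; first by apply: computable_eqn; apply: computable_size.
apply: computable_all; first exact/computable_iota/computable_size.
by apply: computable_eqn; apply: computable_nth; computability;
   [apply: (computable_comp cs) | apply: (computable_comp ct)]; computability.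
Qed.

Lemma computable_mem E (cE : codable E) (n : E -> nat) (s : E -> seq nat) :
  computable n -> computable s -> computable (fun e => n e \in s e).
Proof.
move=> cn cs; apply: (computable_ext (g := fun e =>
    foldr (fun k b => if n e == k then true else b) false (s e))).
  by move=> e; elim: (s e) => //= k t <-; rewrite in_cons; case: eqP.
computability; apply: computable_eqn; computability.
by apply: (computable_comp cn); computability.
Qed.

(** * The decision procedure *)

(** All sequences whose i-th entry is an entry of the i-th given sequence. *)
Definition choices A (ss : seq (seq A)) : seq (seq A) :=
  foldr (fun s ts => [seq x :: t | x <- s, t <- ts]) [:: [::]] ss.

Lemma computable_choices E A (cE : codable E) (cA : codable A)
    (ss : E -> seq (seq A)) :
  computable ss -> computable (fun e => choices (ss e)).
Proof.
move=> css; rewrite /choices; computability.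
apply: computable_flatten; apply: computable_map; computability.
by apply: computable_map; computability.
Qed.

(** The argument lists of an n-ary truth function, in lexicographic order. *)
Definition words n m := choices (nseq n (iota 0 m)).

Lemma computable_words E (cE : codable E) (n m : E -> nat) :
  computable n -> computable m -> computable (fun e => words (n e) (m e)).
Proof.
by move=> cn cm; apply/computable_choices/computable_nseq/computable_iota.
Qed.

Definition tables n m :=
  choices [seq [seq (w, v) | v <- iota 0 m] | w <- words n m].

Lemma computable_tables E (cE : codable E) (n m : E -> nat) :
  computable n -> computable m -> computable (fun e => tables (n e) (m e)).
Proof.
move=> cn cm; apply/computable_choices/computable_map.
  exact: computable_words.
apply: computable_map; last by computability.
by apply: computable_iota; apply: (computable_comp cm); computability.
Qed.

(** The codes of the sets of truth values: each value is either kept or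
    dropped, which leaves an increasing sequence. *)
Definition subseqs m :=
  [seq flatten s | s <- choices [seq [:: [:: x]; [::]] | x <- iota 0 m]].

Lemma computable_subseqs E (cE : codable E) (m : E -> nat) :
  computable m -> computable (fun e => subseqs (m e)).
Proof.
move=> cm; apply: computable_map.
  2: by apply: computable_flatten; computability.
apply/computable_choices/computable_map; last by computability.
exact: computable_iota.
Qed.

Notation raw_table := (seq (seq nat * nat)).
Notation raw_logic := (seq nat * seq raw_table)%type.

Definition logics (ar : seq nat) m : seq raw_logic :=
  [seq (D, T) | D <- subseqs m, T <- choices [seq tables n m | n <- ar]].

Lemma computable_logics E (cE : codable E) (ar : E -> seq nat) m :
  computable ar -> computable m -> computable (fun e => logics (ar e) (m e)).
Proof.
apply: computable_comp2.
apply/computable_flatten/computable_map.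
  by apply: computable_subseqs; computability.
apply: computable_map; last by computability.
apply/computable_choices/computable_map; first by computability.
by apply: computable_tables; computability.
Qed.

Definition lookup (t : raw_table) (w : seq nat) : nat :=
  foldr (fun p y => if p.1 == w then p.2 else y) 0 t.

Definition value (T : seq raw_table) (v : seq nat) : raw_formula -> nat :=
  formula_fold (nth 0 v) (fun j ys => lookup (nth [::] T j) ys).

Definition satb (M : raw_logic) v F := value M.2 v F \in M.1.

Lemma computable_satb E (cE : codable E) (M : E -> raw_logic) v F :
  computable M -> computable v -> computable F ->
  computable (fun e => satb (M e) (v e) (F e)).
Proof.
apply: computable_comp3; apply: computable_mem; last by computability.
apply: computable_formula_fold; first by computability.
  by apply: computable_nth; computability.
rewrite /lookup; computability; first by apply: computable_nth; computability.
by apply: computable_eqseq; computability.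
Qed.

Definition tautb N m (M : raw_logic) F := all (fun v => satb M v F) (words N m).

Lemma computable_tautb E (cE : codable E) (N m : E -> nat)
    (M : E -> raw_logic) F :
  computable N -> computable m -> computable M -> computable F ->
  computable (fun e => tautb (N e) (m e) (M e) (F e)).
Proof.
move=> cN cm cM cF; apply: computable_all; first exact: computable_words.
by apply: computable_satb; computability; [apply: (computable_comp cM)
  | apply: (computable_comp cF)]; computability.
Qed.

(** An upper bound for the indices of the variables. *)
Definition var_bound : raw_formula -> nat :=
  formula_fold S (fun _ ns => foldr maxn 0 ns).

Notation raw_calculus :=
  (seq raw_formula * seq (seq raw_formula * raw_formula))%type.

Definition calculus_bound (C : raw_calculus) :=
  foldr maxn 0 (map var_bound (C.1 ++ flatten [seq r.2 :: r.1 | r <- C.2])).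

Lemma computable_calculus_bound : computable calculus_bound.
Proof.
rewrite /calculus_bound; computability.
  2: by apply: computable_max; computability.
apply: computable_map; last first.
  apply: computable_formula_fold; computability.
  by apply: computable_max; computability.
apply: computable_cat; computability; apply: computable_flatten.
by apply: computable_map; computability.
Qed.

Definition coverb m (C : raw_calculus) (M : raw_logic) :=
  all (tautb (calculus_bound C) m M) C.1 &&
  all (fun r => all (fun v => all (satb M v) r.1 ==> satb M v r.2)
                    (words (calculus_bound C) m)) C.2.

Lemma computable_coverb E (cE : codable E) (m : E -> nat) C M :
  computable m -> computable C -> computable M ->
  computable (fun e => coverb (m e) (C e) (M e)).
Proof.
apply: computable_comp3.
have cN X (cX : codable X) (C' : X -> raw_calculus) :
    computable C' -> computable (fun x => calculus_bound (C' x)).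
  by move=> cC; apply: (computable_comp computable_calculus_bound).
apply: computable_and; (apply: computable_all; first by computability).
  by apply: computable_tautb; computability; apply: cN; computability.
apply: computable_all.
  by apply: computable_words; computability; apply: cN; computability.
apply: computable_implies; last by apply: computable_satb; computability.
by apply: computable_all; [| apply: computable_satb]; computability.
Qed.

(** The formulas of depth less than [d] in the variables below [m], where [ar]
    lists the arities of the connectives. *)
Definition formulas m (ar : seq nat) d : seq raw_formula :=
  iter d (fun Fs => [seq GenTree.Leaf k | k <- iota 0 m] ++
    flatten [seq [seq GenTree.Node j s | s <- choices (nseq (nth 0 ar j) Fs)]
            | j <- iota 0 (size ar)]) [::].

(** The number of pairs of m-ary functions on m values, which bounds the length
    of a strictly increasing chain of sets of such pairs. *)
Definition depth m := m ^ (m ^ m) * m ^ (m ^ m).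

Lemma computable_formulas E (cE : codable E) (m : E -> nat) ar d :
  computable m -> computable ar -> computable d ->
  computable (fun e => formulas (m e) (ar e) (d e)).
Proof.
apply: computable_comp3; rewrite /formulas; computability.
apply: computable_cat.
  by apply: computable_map; first apply: computable_iota; computability.
apply: computable_flatten; apply: computable_map.
  by apply/computable_iota/computable_size; computability.
apply: computable_map; last by computability.
apply: computable_choices; apply: computable_nseq; last by computability.
by apply: computable_nth; computability.
Qed.

Definition better_eqb m ar (M1 M2 : raw_logic) :=
  all (fun F => tautb m m M1 F ==> tautb m m M2 F) (formulas m ar (depth m)).

Lemma computable_better_eqb E (cE : codable E) (m : E -> nat) ar M1 M2 :
  computable m -> computable ar -> computable M1 -> computable M2 ->
  computable (fun e => better_eqb (m e) (ar e) (M1 e) (M2 e)).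
Proof.
move=> cm car cM1 cM2.
apply: (computable_comp
  (g := fun p : nat * seq nat * (raw_logic * raw_logic) =>
          better_eqb p.1.1 p.1.2 p.2.1 p.2.2)
  (f := fun e => (m e, ar e, (M1 e, M2 e)))); last by computability.
apply: computable_all.
  apply: computable_formulas; computability.
  by do ![apply: computable_mul | apply: computable_exp]; computability.
by apply: computable_implies; apply: computable_tautb; computability.
Qed.

(** [M] is optimal when every cover below it has the same tautologies. *)
Definition optimalb m ar C M :=
  coverb m C M &&
  all (fun M' => coverb m C M' && better_eqb m ar M' M ==> better_eqb m ar M M')
      (logics ar m).

Definition optimal_covers ar C m := filter (optimalb m ar C) (logics ar m).

Lemma computable_optimal_covers :
  computable (fun p : seq nat * raw_calculus * nat =>
                optimal_covers p.1.1 p.1.2 p.2).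
Proof.
apply: computable_filter; first by apply: computable_logics; computability.
apply: computable_and; first by apply: computable_coverb; computability.
apply: computable_all; first by apply: computable_logics; computability.
apply: computable_implies; last by apply: computable_better_eqb; computability.
by apply: computable_and; [apply: computable_coverb
  | apply: computable_better_eqb]; computability.
Qed.

(** * Representation of formulas, calculi and logics by first-order data *)

(** A choice from a family indexed by distinct entries is a function of the
    index.  All enumerations of functions below are instances: of sets of truth
    values, of truth functions, of families of truth functions and of argument
    lists of a connective. *)
Lemma choicesP (W A : eqType) (x0 : A) (S : W -> seq A) (ws : seq W) t :
  uniq ws ->
  reflect (exists2 f : W -> A, {in ws, forall w, f w \in S w} & t = map f ws)
          (t \in choices (map S ws)).
Proof.
elim: ws t => [|w ws IHws] t /=.
  move=> _; rewrite inE; apply: (iffP eqP) => [->|[f _ ->]] //.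
  by exists (fun _ => x0).
move=> /andP[w_ws uws]; apply: (iffP allpairsP) => [[[x s] /= []]|[f fS ->]].
  move=> xS /(IHws _ uws)[f fS ->] ->.
  exists (fun v => if v == w then x else f v) => [v|].
    by rewrite inE; case: eqP => [->|_ /= /fS].
  rewrite /= eqxx; congr (_ :: _); apply/eq_in_map => v v_ws.
  by case: eqP v_ws w_ws => // -> ->.
exists (f w, map f ws); split=> //=; first by apply: fS; rewrite mem_head.
by apply/IHws => //; exists f => // v v_ws; apply: fS; rewrite inE v_ws orbT.
Qed.

Lemma formula_induction (L : language) (P : formula L -> Prop) :
  (forall n, P (PropVar L n)) ->
  (forall (j : 'I_(last_conn L).+1) (args : formula L ^ arity j),
     (forall i, P (args i)) -> P (Conn args)) ->
  forall F, P F.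
Proof.
move=> Pvar Pconn; fix IH 1; case=> [n|j args]; first exact: Pvar.
by apply: Pconn => i; apply: IH.
Qed.

Section Representation.
Variable L : language.
Notation conns := (enum 'I_(last_conn L).+1).

Definition arities : seq nat := [seq arity j | j <- conns].

Fixpoint to_raw (F : formula L) : raw_formula :=
  match F with
  | PropVar n => GenTree.Leaf n
  | Conn j args => GenTree.Node j [seq to_raw (args i) | i <- enum 'I_(arity j)]
  end.

Definition raw_calculus_of (C : calculus L) : raw_calculus :=
  (map to_raw (axioms C),
   [seq (map to_raw (premises r), to_raw (conclusion r)) | r <- rules C]).

Lemma enc_arities : enc_language L = enc arities.
Proof. by rewrite /enc_language /enc /= /arities -map_comp. Qed.

Lemma enc_to_raw F : enc_formula F = enc (to_raw F).
Proof.
elim/formula_induction: F => //= j args IH; rewrite /enc /=.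
by rewrite -map_comp; congr (scott 2 1 [:: _; enc_list _]); apply: eq_map => i.
Qed.

Lemma enc_seq_to_raw s : enc_list (map (@enc_formula L) s) = enc (map to_raw s).
Proof. by rewrite /enc /= -map_comp (eq_map enc_to_raw). Qed.

Lemma enc_raw_calculus C : enc_calculus C = enc (raw_calculus_of C).
Proof.
rewrite /enc_calculus {1}enc_seq_to_raw; congr (enc_pair _ (enc_list _)).
rewrite -map_comp; apply: eq_map => r.
by rewrite /enc_rule {1}enc_seq_to_raw enc_to_raw.
Qed.

Lemma size_arities : size arities = (last_conn L).+1.
Proof. by rewrite size_map size_enum_ord. Qed.

Lemma nth_conns A (x0 : A) (f : 'I_(last_conn L).+1 -> A)
    (j : 'I_(last_conn L).+1) :
  nth x0 (map f conns) j = f j.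
Proof. by rewrite (nth_map j) ?size_enum_ord // nth_ord_enum. Qed.

Section Logics.
Variable m : nat.

Definition raw_word n (w : n.-tuple 'I_m) : seq nat := map val w.

Definition raw_table_of n (f : {ffun n.-tuple 'I_m -> 'I_m}) : raw_table :=
  [seq (raw_word w, val (f w)) | w <- all_tuples m n].

Definition raw_logic_of (M : mvlogic L m) : raw_logic :=
  (map val (enum (designated M)), [seq raw_table_of (truth M j) | j <- conns]).

Lemma enc_raw_logic M : enc_logic M = enc (raw_logic_of M).
Proof.
congr (enc_pair (enc_list _) (enc_list _)); rewrite -[RHS]map_comp //.
apply: eq_map => j; congr enc_list; rewrite -[RHS]map_comp.
by apply: eq_map => w; congr (enc_pair (enc_list _) _); rewrite -[RHS]map_comp.
Qed.

Lemma raw_word_inj n : injective (@raw_word n).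
Proof. by move=> u w /(inj_map val_inj)/val_inj. Qed.

Lemma mem_all_tuples n (w : n.-tuple 'I_m) : w \in all_tuples m n.
Proof.
elim: n w => [|n IHn] w /=; first by rewrite tuple0 inE.
case/tupleP: w => i w.
apply/allpairsP; exists (i, w); rewrite mem_enum IHn.
by split=> //; apply: val_inj.
Qed.

Lemma uniq_all_tuples n : uniq (all_tuples m n).
Proof.
elim: n => //= n IHn; apply: allpairs_uniq => //; first exact: enum_uniq.
by move=> [i u] [j w] _ _ /= /(congr1 val)[-> /val_inj ->].
Qed.

Lemma wordsE n : words n m = map (@raw_word n) (all_tuples m n).
Proof.
elim: n => //= n; rewrite /words /= => ->; rewrite -val_enum_ord.
rewrite allpairs_mapl allpairs_mapr map_allpairs.
by [].
Qed.

Lemma mem_words n (v : seq nat) :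
  reflect (exists w : n.-tuple 'I_m, v = raw_word w) (v \in words n m).
Proof.
rewrite wordsE; apply: (iffP mapP) => [[w _ ->]|[w ->]]; exists w => //.
exact: mem_all_tuples.
Qed.

Lemma mem_tables n (t : raw_table) :
  reflect (exists f, t = @raw_table_of n f) (t \in tables n m).
Proof.
rewrite /tables wordsE -map_comp.
apply: (iffP (choicesP ([::], 0) _ _ (uniq_all_tuples n))).
  move=> [f fS ->].
  have /fin_all_exists[g fE] w : exists v : 'I_m, f w = (raw_word w, val v).
    have /mapP[v] := fS w (mem_all_tuples w).
    by rewrite mem_iota => /= v_m ->; exists (Ordinal v_m).
  by exists (finfun g); apply: eq_map => w; rewrite fE ffunE.
move=> [f ->]; exists (fun w => (raw_word w, val (f w))) => // w _.
by apply/mapP; exists (val (f w)); rewrite ?mem_iota /=.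
Qed.

Lemma flatten_singletons A B (a : pred A) (g : A -> B) (s : seq A) :
  flatten [seq if a x then [:: g x] else [::] | x <- s] = map g (filter a s).
Proof. by elim: s => //= x s ->; case: (a x). Qed.

Lemma mem_subseqs (d : seq nat) :
  reflect (exists D : {set 'I_m}, d = map val (enum D)) (d \in subseqs m).
Proof.
rewrite /subseqs -val_enum_ord -map_comp.
have enumE (D : {set 'I_m}) : enum D = filter (mem D) (enum 'I_m).
  by rewrite enumT.
apply: (iffP mapP) => [[s s_m ->]|[D ->]].
  have [f fS ->] := choicesP [::] _ _ (enum_uniq _) s_m.
  exists [set i | f i != [::]]; rewrite enumE -[RHS]flatten_singletons.
  congr flatten; apply: eq_map => i; rewrite /= inE.
  by have := fS i; rewrite mem_enum !inE => /(_ isT)/orP[]/eqP->.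
exists [seq if i \in D then [:: val i] else [::] | i <- enum 'I_m].
  apply/choicesP; [exact: [::]|exact: enum_uniq|].
  by exists (fun i => if i \in D then [:: val i] else [::]) => // i _;
    rewrite !inE; case: ifP; rewrite eqxx ?orbT.
by rewrite flatten_singletons enumE.
Qed.

Lemma mem_logics r :
  reflect (exists M, r = raw_logic_of M) (r \in logics arities m).
Proof.
have tablesE : [seq tables n m | n <- arities] =
    [seq tables (arity j) m | j <- conns] by rewrite -map_comp.
rewrite /logics tablesE {tablesE}; apply: (iffP allpairsP).
  move=> [[d T] /= [d_m T_ar ->]].
  have /mem_subseqs[D ->] := d_m.
  have [f fS ->] := choicesP [::] _ _ (enum_uniq _) T_ar.
  have /fin_all_exists[g fE] j : exists g, f j = @raw_table_of (arity j) g.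
    by apply/mem_tables/fS; rewrite mem_enum.
  exists (D, [ffun j => g j]); congr (_, _).
  by apply: eq_map => j; rewrite fE /truth ffunE.
move=> [M ->]; exists (raw_logic_of M); split=> //=.
  by apply/mem_subseqs; exists (designated M).
apply/choicesP; [exact: [::] | exact: enum_uniq |].
exists (fun j => raw_table_of (truth M j)) => // j _.
by apply/mem_tables; exists (truth M j).
Qed.

Lemma lookup_raw_table n (f : {ffun n.-tuple 'I_m -> 'I_m}) w :
  lookup (raw_table_of f) (raw_word w) = f w.
Proof.
rewrite /raw_table_of; have := mem_all_tuples w.
elim: (all_tuples m n) => //= u s IHs; rewrite inE.
have [->|wu /= /IHs <-] := eqVneq w u; first by rewrite eqxx.
by rewrite eq_sym (inj_eq (@raw_word_inj n)) (negPf wu).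
Qed.

(** Makes the list of covers recoverable from the list of their codes. *)
Lemma raw_logic_inj : injective raw_logic_of.
Proof.
move=> M M' [/(inj_map val_inj) eqD eqT].
have eq_truth j : truth M j = truth M' j.
  apply/ffunP=> w; apply: ord_inj; rewrite -!lookup_raw_table.
  rewrite -(nth_conns [::] (fun j => raw_table_of (truth M j))) eqT.
  by rewrite nth_conns.
case: M M' => D T [D' T'] in eqD eqT eq_truth *; congr (_, _).
  by apply/setP=> i; have := mem_enum (mem D) i; rewrite eqD mem_enum.
by apply/ffunP=> j; apply: eq_truth.
Qed.

End Logics.
End Representation.

(** * Correctness of the decision procedure *)

Lemma foldr_maxn_leq s N : (foldr maxn 0 s <= N) = all (leq^~ N) s.
Proof. by elim: s => //= n s IHs; rewrite geq_max IHs. Qed.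

Lemma all_InP A B (p : pred B) (f : A -> B) s :
  all p (map f s) <-> (forall x, List.In x s -> p (f x)).
Proof.
elim: s => //= x s [IH1 IH2]; split=> [/andP[px /IH1 ps] y [<-|/ps] //|ps].
by rewrite ps ?IH2 //=; [move=> y ys; apply: ps; right | left].
Qed.

Lemma nseq_enum A n (x : A) : nseq n x = [seq x | _ <- enum 'I_n].
Proof.
by rewrite -[in LHS](size_enum_ord n); elim: (enum _) => //= i s ->.
Qed.

Lemma formulasS m ar d : formulas m ar d.+1 =
  [seq GenTree.Leaf n | n <- iota 0 m] ++
  flatten [seq [seq GenTree.Node j s
               | s <- choices (nseq (nth 0 ar j) (formulas m ar d))]
          | j <- iota 0 (size ar)].
Proof. by []. Qed.

Section Correctness.
Variables (L : language) (k : nat).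
Notation m := k.+1.
Implicit Types (M : mvlogic L m) (F : formula L) (v : nat -> 'I_m).

(** Variables from [N] on get the value 0, which is also the default value used
    when a variable is looked up in a raw word; hence [value_to_raw] holds
    without a bound on the variables of the formula. *)
Definition valuation N (w : N.-tuple 'I_m) : nat -> 'I_m := nth ord0 w.

Lemma value_to_raw M N (w : N.-tuple 'I_m) F :
  value (raw_logic_of M).2 (raw_word w) (to_raw F) = eval M (valuation w) F.
Proof.
elim/formula_induction: F => [n|j args IH] /=.
  rewrite /value /= /raw_word /valuation.
  have [nN|Nn] := ltnP n N; first by rewrite (nth_map ord0) ?size_tuple.
  by rewrite !nth_default ?size_map ?size_tuple.
rewrite /value /= nth_conns -lookup_raw_table; congr lookup.
rewrite /raw_word /= -[LHS]map_comp -[RHS]map_comp; apply: eq_map => i.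
by rewrite /= -IH.
Qed.

Lemma satb_to_raw M N (w : N.-tuple 'I_m) F :
  satb (raw_logic_of M) (raw_word w) (to_raw F) =
  (eval M (valuation w) F \in designated M).
Proof. by rewrite /satb value_to_raw (mem_map val_inj) mem_enum. Qed.

Lemma var_bound_Conn N (j : 'I_(last_conn L).+1) (args : formula L ^ arity j) :
  (var_bound (to_raw (Conn args)) <= N) =
  [forall i, var_bound (to_raw (args i)) <= N].
Proof.
rewrite /var_bound /= foldr_maxn_leq -map_comp all_map.
apply/allP/forallP => [le_N i|le_N i _]; last exact: le_N.
by apply: le_N; rewrite mem_enum.
Qed.

Lemma eq_eval M N v v' F :
  var_bound (to_raw F) <= N -> (forall n, n < N -> v n = v' n) ->
  eval M v F = eval M v' F.
Proof.
move=> + vv'; elim/formula_induction: F => [n|j args IH]; first exact: vv'.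
rewrite var_bound_Conn => /forallP le_N /=; congr (truth M j _).
by apply: eq_mktuple => i; apply: IH.
Qed.

Lemma eval_truncate M N v F : var_bound (to_raw F) <= N ->
  eval M (valuation [tuple v i | i < N]) F = eval M v F.
Proof.
move=> F_N; apply: (eq_eval _ F_N) => n nN.
exact: (nth_mktuple (fun i : 'I_N => v i) ord0 (Ordinal nN)).
Qed.

Lemma tautbP N M F : var_bound (to_raw F) <= N ->
  reflect (taut M F) (tautb N m (raw_logic_of M) (to_raw F)).
Proof.
move=> F_N; apply: (iffP allP) => [tF v|tF _ /mem_words[w ->]].
  rewrite /satisfies -(eval_truncate M v F_N) -satb_to_raw; apply: tF.
  by apply/mem_words; eexists.
by rewrite satb_to_raw; apply: tF.
Qed.

Section Calculus.
Variable C : calculus L.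
Notation N := (calculus_bound (raw_calculus_of C)).

Lemma calculus_boundP :
  (forall A, List.In A (axioms C) -> var_bound (to_raw A) <= N) /\
  (forall r, List.In r (rules C) ->
     var_bound (to_raw (conclusion r)) <= N /\
     forall A, List.In A (premises r) -> var_bound (to_raw A) <= N).
Proof.
have := leqnn N; rewrite {1}/calculus_bound foldr_maxn_leq map_cat all_cat /=.
case/andP; rewrite -map_comp => /all_InP leA leR; split=> // r r_C.
have : all (leq^~ N) (map var_bound (to_raw (conclusion r) ::
         map (@to_raw L) (premises r))).
  move: leR; generalize N => N'.
  elim: (rules C) r_C => //= r' rs IHrs [<-|r_rs].
    by rewrite map_cat all_cat => /and3P[/= -> ->].
  by rewrite map_cat all_cat => /and3P[_ _ /(IHrs r_rs)].
by rewrite /= -map_comp => /andP[le_c /all_InP le_p].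
Qed.

Lemma coverbP M :
  reflect (Defs.cover C M) (coverb m (raw_calculus_of C) (raw_logic_of M)).
Proof.
have [leA leR] := calculus_boundP.
apply: (iffP andP) => -[].
  move=> /all_InP tA /all_InP tR; split=> [A A_C|r r_C v vP].
    by apply/tautbP/tA => //; apply: leA.
  have [le_c le_p] := leR r r_C.
  have vN : raw_word [tuple v i | i < N] \in words N m.
    by apply/mem_words; eexists.
  have /implyP := allP (tR r r_C) _ vN.
  rewrite satb_to_raw eval_truncate //; apply.
  apply/all_InP => A A_r; rewrite satb_to_raw eval_truncate ?vP //.
  exact: le_p.
move=> tA tR; split; apply/all_InP; [move=> A A_C | move=> r r_C].
  by apply/(tautbP _ (leA _ A_C))/tA.
apply/allP => _ /mem_words[w ->]; apply/implyP => /all_InP wP.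
rewrite satb_to_raw; apply: tR => // A A_r.
by rewrite /satisfies -satb_to_raw; apply: wP.
Qed.

End Calculus.

Lemma formulas_to_raw d G : G \in formulas m (arities L) d ->
  exists2 F : formula L, to_raw F = G & var_bound (to_raw F) <= m.
Proof.
elim: d G => [//|d IHd] G; rewrite formulasS mem_cat => /orP[/mapP[n]|].
  by rewrite mem_iota => /= n_m ->; exists (PropVar L n).
case/flatten_mapP=> j; rewrite mem_iota size_arities => /= j_L /mapP[s].
rewrite (nth_conns 0 (@arity L) (Ordinal j_L)) => s_d ->.
set i := Ordinal j_L in s_d *.
rewrite nseq_enum in s_d.
have [f fd ->] := choicesP (GenTree.Leaf 0) _ _ (enum_uniq _) s_d.
have /fin_all_exists2[g gE g_m] a : exists2 F : formula L,
    to_raw F = f a & var_bound (to_raw F) <= m.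
  by apply/IHd/fd; rewrite mem_enum.
exists (Conn (finfun g : formula L ^ arity i)).
  by congr (GenTree.Node j _); apply: eq_map => a; rewrite ffunE.
by rewrite var_bound_Conn; apply/forallP => a; rewrite ffunE.
Qed.

Section Comparison.
Variables M1 M2 : mvlogic L m.

Notation P :=
  ({ffun m.-tuple 'I_m -> 'I_m} * {ffun m.-tuple 'I_m -> 'I_m})%type.

(** The two functions that a formula in m variables defines are recorded
    together, because refuting an inclusion of tautologies takes one formula
    that is valid in [M1] and not in [M2]. *)
Definition behaviour F : P :=
  ([ffun w => eval M1 (valuation w) F], [ffun w => eval M2 (valuation w) F]).

Definition apply_conn (j : 'I_(last_conn L).+1)
    (a : {ffun 'I_(arity j) -> P}) : P :=
  ([ffun w => truth M1 j [tuple (a i).1 w | i < arity j]],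
   [ffun w => truth M2 j [tuple (a i).2 w | i < arity j]]).

(** The operator whose d-th iterate on the empty set collects the behaviours of
    the formulas of depth less than [d]. *)
Definition behaviour_step (X : {set P}) : {set P} :=
  [set x | [exists n : 'I_m, x == behaviour (PropVar L n)] ||
           [exists j, [exists a : {ffun 'I_(arity j) -> P},
              [forall i, a i \in X] && (x == apply_conn a)]]].

Lemma behaviour_Conn (j : 'I_(last_conn L).+1) (args : formula L ^ arity j) :
  behaviour (Conn args) = apply_conn [ffun i => behaviour (args i)].
Proof.
by congr (_, _); apply/ffunP => w; rewrite !ffunE /=; congr (truth _ _ _);
  apply: eq_mktuple => i; rewrite !ffunE.
Qed.

Lemma behaviour_step_mono : {homo behaviour_step : X Y / X \subset Y}.
Proof.
move=> X Y /subsetP XY; apply/subsetP => x; rewrite !inE => /orP[->//|].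
case/existsP=> j /existsP[a /andP[/forallP aX xE]]; apply/orP; right.
apply/existsP; exists j; apply/existsP; exists a.
by rewrite xE andbT; apply/forallP => i; apply: XY.
Qed.

(** The least fixed point contains the variables and is closed under the
    connectives. *)
Lemma behaviour_fixset F :
  var_bound (to_raw F) <= m -> behaviour F \in fixset behaviour_step.
Proof.
elim/formula_induction: F => [n n_m|j args IH].
  rewrite -(fixsetK behaviour_step_mono) inE; apply/orP; left.
  by apply/existsP; exists (Ordinal n_m).
rewrite var_bound_Conn => /forallP le_m.
rewrite -(fixsetK behaviour_step_mono) inE behaviour_Conn; apply/orP; right.
apply/existsP; exists j; apply/existsP.
exists [ffun i => behaviour (args i)]; apply/andP; split=> //.
by apply/forallP => i; rewrite ffunE; apply: IH.
Qed.

Lemma behaviour_iter d x : x \in iter d behaviour_step set0 ->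
  exists2 F, to_raw F \in formulas m (arities L) d & behaviour F = x.
Proof.
elim: d x => [|d IHd] x; first by rewrite inE.
rewrite iterS inE => /orP[/existsP[n /eqP->]|].
  exists (PropVar L n) => //; rewrite formulasS mem_cat; apply/orP; left.
  by apply/mapP; exists (val n); rewrite ?mem_iota /=.
case/existsP=> j /existsP[a /andP[/forallP aX /eqP->]].
have /fin_all_exists2[g g_d gE] i := IHd _ (aX i).
exists (Conn (finfun g : formula L ^ arity j)); last first.
  by rewrite behaviour_Conn; congr apply_conn; apply/ffunP => i; rewrite !ffunE.
rewrite formulasS mem_cat; apply/orP; right; apply/flatten_mapP; exists (val j).
  by rewrite mem_iota size_arities /=.
apply/mapP; eexists; last by [].
rewrite nth_conns nseq_enum.
apply/choicesP; [exact: GenTree.Leaf 0 | exact: enum_uniq |].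
by exists (fun i => to_raw (finfun g i)) => // i _; rewrite ffunE.
Qed.

Lemma card_behaviours : #|{: P}| = depth m.
Proof. by rewrite card_prod card_ffun card_tuple card_ord. Qed.

(** In m variables, validity is decided by the words of length m, to which the
    behaviour is restricted. *)
Lemma taut_behaviour F G :
  var_bound (to_raw F) <= m -> var_bound (to_raw G) <= m ->
  behaviour F = behaviour G ->
  (taut M1 F <-> taut M1 G) /\ (taut M2 F <-> taut M2 G).
Proof.
move=> F_m G_m [/ffunP eq1 /ffunP eq2].
have eqE M : (forall w : m.-tuple 'I_m,
      eval M (valuation w) F = eval M (valuation w) G) ->
    taut M F <-> taut M G.
  move=> eqM; have eq_eval' v : eval M v F = eval M v G.
    by rewrite -(eval_truncate M v F_m) eqM eval_truncate.
  by split=> t v; rewrite /satisfies; [rewrite -eq_eval' | rewrite eq_eval'];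
    apply: t.
by split; apply: eqE => w; [have := eq1 w | have := eq2 w]; rewrite !ffunE.
Qed.

Fixpoint rename (f : nat -> nat) F : formula L :=
  match F with
  | PropVar n => PropVar L (f n)
  | Conn j args => Conn [ffun i => rename f (args i)]
  end.

Lemma eval_rename M f v F : eval M v (rename f F) = eval M (v \o f) F.
Proof.
elim/formula_induction: F => //= j args IH; congr (truth M j _).
by apply: eq_mktuple => i; rewrite ffunE.
Qed.

Lemma var_bound_rename N f F :
  (forall n, f n < N) -> var_bound (to_raw (rename f F)) <= N.
Proof.
move=> f_N; elim/formula_induction: F => [n|j args IH]; first exact: f_N.
by rewrite [rename _ _]/= var_bound_Conn; apply/forallP => i; rewrite ffunE.
Qed.

Lemma better_eqbP :
  reflect (better_eq M1 M2)
          (better_eqb m (arities L) (raw_logic_of M1) (raw_logic_of M2)).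
Proof.
apply: (iffP allP) => [le12 F tF v|le12 G /formulas_to_raw[F <- F_m]].
  (* Identifying the variables with equal value under the refuting valuation
     [v] leaves at most m of them; [inord] then refutes the renamed formula. *)
  pose F' := rename v F.
  have F'_m : var_bound (to_raw F') <= m by apply: var_bound_rename.
  have [G G_d GF'] : exists2 G, to_raw G \in formulas m (arities L) (depth m)
      & behaviour G = behaviour F'.
    by apply: behaviour_iter; rewrite -card_behaviours; apply: behaviour_fixset.
  have G_m : var_bound (to_raw G) <= m.
    by have [G' eqG] := formulas_to_raw G_d; rewrite eqG.
  have [taut1 taut2] := taut_behaviour G_m F'_m GF'.
  have tG : taut M1 G.
    by apply/taut1 => u; rewrite /satisfies eval_rename; apply: tF.
  have /taut2/(_ (fun n => inord n)) : taut M2 G.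
    by apply/(tautbP M2 G_m)/(implyP (le12 _ G_d))/(tautbP M1 G_m).
  rewrite /satisfies eval_rename (@eq_eval _ _ _ v F (leqnn _)) // => n _ /=.
  by rewrite inord_val.
by apply/implyP => /(tautbP _ F_m)/le12/(tautbP _ F_m).
Qed.

End Comparison.
Lemma optimalbP (C : calculus L) M :
  reflect (optimal_cover C M)
          (optimalb m (arities L) (raw_calculus_of C) (raw_logic_of M)).
Proof.
apply: (iffP andP) => -[].
  move=> /coverbP covM /allP opt; split=> // M' /coverbP covM' [le'M neq].
  have M'_in : raw_logic_of M' \in logics (arities L) m.
    by apply/mem_logics; exists M'.
  have /better_eqbP leM' :
      better_eqb m (arities L) (raw_logic_of M) (raw_logic_of M').
    by apply: (implyP (opt _ M'_in)); rewrite covM'; apply/better_eqbP.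
  by apply: neq => F; split; [apply: le'M | apply: leM'].
move=> /coverbP covM opt; split=> //; apply/allP => _ /mem_logics[M' ->].
apply/implyP => /andP[/coverbP covM' /better_eqbP le'M].
apply/negPn/negP => nle; case: (opt M' covM'); split=> // eq_taut.
by case/better_eqbP: nle => F /eq_taut.
Qed.

Lemma mem_optimal_covers (C : calculus L) r :
  reflect (exists2 M : mvlogic L m, optimal_cover C M & r = raw_logic_of M)
          (r \in optimal_covers (arities L) (raw_calculus_of C) m).
Proof.
rewrite mem_filter; apply: (iffP andP).
  move=> [opt /mem_logics[M rE]].
  by exists M => //; apply/optimalbP; rewrite -rE.
by move=> [M /optimalbP opt ->]; split=> //; apply/mem_logics; exists M.
Qed.

End Correctness.

(** Turns the computed list of codes into the list of logics that it codes. *)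
Lemma map_surj (A : Type) (B : eqType) (f : A -> B) (t : seq B) :
  {in t, forall y, exists x, y = f x} -> exists s, t = map f s.
Proof.
elim: t => [|y t IHt] tP; first by exists [::].
have [x ->] := tP y (mem_head _ _).
have [|s ->] := IHt; first by move=> z zt; apply: tP; rewrite inE zt orbT.
by exists (x :: s).
Qed.

(* A single closed_term term [t], uniform in the language, the calculus and m, maps
   the codes of these data to the code of a list of all optimal covers. *)
Theorem proposition4p5 :
  exists t : term, closed_term t /\
    forall (L : language) (C : calculus L) (m : nat), 1 <= m ->
    exists s : seq (mvlogic L m),
      (forall M : mvlogic L m, M \in s <-> optimal_cover C M) /\
      reduces
        (App (App (App t (enc_language L)) (enc_calculus C)) (enc_nat m))
        (enc_list (map (@enc_logic L m) s)).
Proof.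
have [t ct tE] := computable_optimal_covers.
pose T := Lam (Lam (Lam
  (App t (App (App tpair (App (App tpair (Var 2)) (Var 1))) (Var 0))))).
have TE a b c : closed_term a -> closed_term b -> closed_term c ->
    reduces (App (App (App T a) b) c) (App t (enc_pair (enc_pair a b) c)).
  move=> ca cb cc; rewrite /T; do 3!reduce; setoid_rewrite (red_tpair ca cb).
  by setoid_rewrite red_tpair => //; [reflexivity | apply: closed_enc_pair].
exists T; split=> [|L C [//|k] _]; first by rewrite /T; closed.
have [s sE] : exists s : seq (mvlogic L k.+1),
    optimal_covers (arities L) (raw_calculus_of C) k.+1 =
    map (@raw_logic_of L k.+1) s.
  by apply: map_surj => r /mem_optimal_covers[M _ ->]; exists M.
exists s; split=> [M|].
  rewrite -(mem_map (@raw_logic_inj L k.+1)) -sE.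
  split=> [/mem_optimal_covers[M' optM' /raw_logic_inj-> //]|optM].
  by apply/mem_optimal_covers; exists M.
rewrite enc_arities enc_raw_calculus (eq_map (@enc_raw_logic L k.+1)).
rewrite (map_comp enc) -sE.
setoid_rewrite TE; [|exact: enc_closed|exact: enc_closed|exact: closed_enc_nat].
exact: (tE (arities L, raw_calculus_of C, k.+1)).
Qed.
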